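(* Let $N$ be a compact Riemannian manifold and let $u:P_{T_1,T_2}\to N$ be a harmonic map. Then the integral $$\int_{\{t\}\times S^1}\phi(u)\,d\theta$$ is independent of $t\in[T_1,T_2]$, where $$\phi(u)=|u_t|^2-|u_\theta|^2-2i\,u_t\cdot u_\theta.$$
   Context: $P_{T_1,T_2}=[T_1,T_2]\times S^1$ is the cylinder with flat metric $dt^2+d\theta^2$, $S^1=\mathbb{R}/2\pi\mathbb{Z}$; by the paper's convention $T_2-T_1>2$. Norms and the product $u_t\cdot u_\theta$ are taken with respect to the Riemannian metric of $N$. $\phi(u)(dt+i\,d\theta)^2$ is the Hopf quadratic differential of $u$. Harmonic maps are smooth. *)

(* Defs.v *)
From HB Require Import structures.
From mathcomp Require Import all_boot all_order all_algebra complex.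
From mathcomp Require Import all_classical all_reals all_analysis.
Set Implicit Arguments.
Unset Strict Implicit.
Unset Printing Implicit Defensive.
Import Order.TTheory GRing.Theory Num.Theory.
Import numFieldNormedType.Exports.
Local Open Scope classical_set_scope.
Local Open Scope ring_scope.

(* Directional derivatives within a set D: only the increments h *: v that stay
   in D are used.  On an open set these are the library's ['D_v f]
   (lemmas [derivable_in_open], [derive_in_open]); at a boundary point of a
   closed strip they are the one-sided derivatives. *)
Section Smooth.
Context {R : realType} {V W : normedModType R}.
Implicit Types (D : set V) (f : V -> W) (x v : V).

Definition quotient_in D f x v : set_system W :=
  (fun h : R => h^-1 *: ((f \o shift x) (h *: v) - f x)) @
    within [set h | D (shift x (h *: v))] 0^'.

Definition derivable_in D f x v : Prop := cvg (quotient_in D f x v).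

Definition derive_in D f v x : W := lim (quotient_in D f x v).

Fixpoint Ck (k : nat) D f : Prop :=
  {within D, continuous f} /\
  if k is k'.+1 then
    forall v, (forall x, D x -> derivable_in D f x v) /\ Ck k' D (derive_in D f v)
  else True.

Definition smooth D f : Prop := forall k, Ck k D f.

Lemma quotient_in_open D f x v : open D -> D x ->
  quotient_in D f x v =
  (fun h : R => h^-1 *: ((f \o shift x) (h *: v) - f x)) @ 0^'.
Proof.
move=> oD Dx; rewrite /quotient_in; congr (_ @ _).
have D0 : \forall h \near (0 : R)^', D (shift x (h *: v)).
  have c0 : {for (0 : R), continuous (fun h : R => shift x (h *: v))}.
    apply: (@continuousD _ _ _ (fun h : R => h *: v) (cst x)).
      exact: scalel_continuous.
    exact: cst_continuous.
  apply: (@cvg_within _ (nbhs (0 : R))); apply: c0.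
  by apply: open_nbhs_nbhs; split; rewrite //= scale0r add0r.
apply/seteqP; split=> A; last exact: cvg_within.
by move=> wA; apply: filterS2 D0 wA => h Dh; apply.
Qed.

Lemma derivable_in_open D f x v : open D -> D x ->
  derivable_in D f x v <-> derivable f x v.
Proof. by move=> oD Dx; rewrite /derivable_in quotient_in_open. Qed.

Lemma derive_in_open D f x v : open D -> D x -> derive_in D f v x = 'D_v f x.
Proof. by move=> oD Dx; rewrite /derive_in quotient_in_open. Qed.

End Smooth.

Definition bilin {R : realType} {n : nat} (G : 'M[R]_n) (v w : 'rV[R]_n) : R :=
  (v *m G *m w^T) 0 0.

Record chart (R : realType) (n : nat) (N : topologicalType) := Chart {
  cdom : set N;
  cimg : set 'rV[R]_n;
  cmap :> N -> 'rV[R]_n;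
  cinv : 'rV[R]_n -> N;
  cdom_open : open cdom;
  cimg_open : open cimg;
  cmapP : forall x, cdom x -> cimg (cmap x) /\ cinv (cmap x) = x;
  cinvP : forall y, cimg y -> cdom (cinv y) /\ cmap (cinv y) = y;
  cmap_continuous : {within cdom, continuous cmap};
  cinv_continuous : {within cimg, continuous cinv}
}.

Definition overlap {R : realType} {n : nat} {N : topologicalType}
  (c c' : chart R n N) : set 'rV[R]_n := cimg c `&` cinv c @^-1` cdom c'.

Definition transition {R : realType} {n : nat} {N : topologicalType}
  (c c' : chart R n N) : 'rV[R]_n -> 'rV[R]_n := c' \o cinv c.

(* [metric i y] is the Gram matrix (g_ab) at the point of coordinates y of the
   coordinate frame of the chart i; [metric_transition] is the transformation
   law of a covariant 2-tensor. *)
Record riemannianManifold (R : realType) (n : nat) := RiemannianManifold {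
  points :> topologicalType;
  hausdorffM : hausdorff_space points;
  second_countableM : @second_countable points;
  atlasIndex : Type;
  atlas : atlasIndex -> chart R n points;
  atlas_cover : forall x, exists i, cdom (atlas i) x;
  transition_smooth : forall i j,
    smooth (overlap (atlas i) (atlas j)) (transition (atlas i) (atlas j));
  metric : atlasIndex -> 'rV[R]_n -> 'M[R]_n;
  metric_smooth : forall i, smooth (cimg (atlas i)) (metric i);
  metric_sym : forall i y, cimg (atlas i) y -> (metric i y)^T = metric i y;
  metric_pos : forall i y, cimg (atlas i) y ->
    forall v, v != 0 -> 0 < bilin (metric i y) v v;
  metric_transition : forall i j y, overlap (atlas i) (atlas j) y ->
    let tau := transition (atlas i) (atlas j) in
    forall v w, bilin (metric i y) v w =
                bilin (metric j (tau y)) ('D_v tau y) ('D_w tau y)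
}.

Section HarmonicMaps.
Context {R : realType} {n : nat} (N : riemannianManifold R n).

(* Gamma^k_ab = 1/2 sum_l g^kl (d_a g_bl + d_b g_al - d_l g_ab) *)
Definition christoffel (i : atlasIndex N) (k a b : 'I_n) (y : 'rV[R]_n) : R :=
  let g b' c' := fun z => metric i z b' c' in
  let d a' f := 'D_(delta_mx 0 a') f y in
  2^-1 * \sum_(l < n) invmx (metric i y) k l *
    (d a (g b l) + d b (g a l) - d l (g a b)).

(* A map on the cylinder [T1, T2] x R/2piZ is represented by its lift to the
   strip [T1, T2] x R, which is 2pi-periodic in the second variable; the values
   of u outside the strip are irrelevant. *)
Variables (T1 T2 : R) (u : R * R -> N).

Definition strip : set (R * R) := [set p | T1 <= p.1 <= T2].

Definition d_t : R * R := (1, 0).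
Definition d_theta : R * R := (0, 1).

Definition chart_preimage (i : atlasIndex N) : set (R * R) :=
  strip `&` u @^-1` cdom (atlas i).

Definition du (i : atlasIndex N) (v p : R * R) : 'rV[R]_n :=
  derive_in (chart_preimage i) (atlas i \o u) v p.

Definition ddu (i : atlasIndex N) (v w p : R * R) : 'rV[R]_n :=
  derive_in (chart_preimage i) (du i w) v p.

Definition smooth_map : Prop :=
  {within strip, continuous u} /\
  forall i, smooth (chart_preimage i) (atlas i \o u).

(* The tension field trace(nabla du) in the chart i, for the flat metric
   dt^2 + dtheta^2 on the cylinder. *)
Definition tension (i : atlasIndex N) (p : R * R) : 'rV[R]_n :=
  let y := atlas i (u p) in
  let ut := du i d_t p in
  let utheta := du i d_theta p in
  ddu i d_t d_t p + ddu i d_theta d_theta p +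
  \row_k \sum_(a < n) \sum_(b < n) christoffel i k a b y *
    (ut 0 a * ut 0 b + utheta 0 a * utheta 0 b).

Definition harmonic_map : Prop :=
  [/\ forall t theta, T1 <= t <= T2 -> u (t, theta + 2 * pi) = u (t, theta),
      smooth_map &
      forall i p, chart_preimage i p -> tension i p = 0].

(* The scalar product g(du(v), du(w)) at u p.  By [metric_transition] it does
   not depend on the chart around u p used to compute it. *)
Definition pullback_metric (v w p : R * R) : R :=
  let i := projT1 (cid (atlas_cover (u p))) in
  bilin (metric i (atlas i (u p))) (du i v p) (du i w p).

Local Open Scope complex_scope.

Definition hopf (p : R * R) : R[i] :=
  (pullback_metric d_t d_t p)%:C - (pullback_metric d_theta d_theta p)%:C
  - 2 * 'i%C * (pullback_metric d_t d_theta p)%:C.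

End HarmonicMaps.

Definition circle_integral {R : realType} (f : R -> R[i]) : R[i] :=
  Complex (\int[lebesgue_measure]_(x in `[0%R, (2 * pi)%R]) complex.Re (f x))
          (\int[lebesgue_measure]_(x in `[0%R, (2 * pi)%R]) complex.Im (f x)).

(* Main.v *)
Require Import Defs.
From mathcomp Require Import all_boot all_order all_algebra complex.
From mathcomp Require Import all_classical all_reals all_analysis.
From mathcomp Require Import ring lra.
Set Implicit Arguments.
Unset Strict Implicit.
Unset Printing Implicit Defensive.
Import Order.TTheory GRing.Theory Num.Theory.
Import numFieldNormedType.Exports.
Local Open Scope classical_set_scope.
Local Open Scope ring_scope.

(* Put E = |u_t|^2 - |u_theta|^2 and F = -2 u_t . u_theta.  In a chart, the
   harmonic map equation and the symmetry of second derivatives give the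
   Cauchy-Riemann equations d_t E = d_theta F and d_t F = - d_theta E on the
   interior of the cylinder.  Hence the t-derivatives of the integrals of E and
   F over the circles are integrals of theta-derivatives of periodic functions,
   so they vanish for T1 < t < T2; the two integrals are continuous on the
   closed interval [T1, T2], because E and F are continuous up to the boundary.
   The one-sided derivatives at the boundary transform like the interior ones
   under a change of chart, so that E and F may be computed there in any chart. *)

(** * Differential calculus *)

Lemma mx_cvgP (R : realType) (T : Type) (F : set_system T) {FF : Filter F}
    (m n : nat) (q : T -> 'M[R]_(m, n)) (l : 'M[R]_(m, n)) :
  q @ F --> l <-> forall i j, (fun h => q h i j) @ F --> l i j.
Proof.
split=> [ql i j|ql].
  exact: (cvg_comp _ _ ql (@coord_continuous _ _ _ i j l)).
apply/cvgrPdist_le => /= e e0.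
near=> x.
rewrite /Num.Def.normr/= mx_normrE (bigmax_le _ (ltW e0))//= => i _.
rewrite !mxE/=.
move: i; near: x; apply: filter_forall => /= i.
exact: ((cvgrPdist_le _ _).1 (ql i.1 i.2)).
Unshelve. all: by end_near. Qed.

Lemma is_derive_line (R : realType) (V W : normedModType R) (f : V -> W)
    (x v : V) (s : R) :
  derivable f (x + s *: v) v ->
  is_derive s 1 (fun s => f (x + s *: v)) ('D_v f (x + s *: v)).
Proof.
move=> df.
have qE : (fun h : R => h^-1 *: (((fun s => f (x + s *: v)) \o shift s) (h *: 1)
      - f (x + s *: v))) =
    (fun h => h^-1 *: ((f \o shift (x + s *: v)) (h *: v) - f (x + s *: v))).
  apply/funext => h /=; congr (_ *: (f _ - _)).
  by rewrite scalerDl addrCA [h *: 1]mulr1.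
by split; rewrite /derivable ?/derive qE.
Qed.

(** The one-variable mean value theorem along the line through [x] in direction [v]. The sign of [k]
    is free, so the intermediate parameter is located only by its absolute value, which is all that
    estimates near [x] require. *)
Lemma MVT_line (R : realType) (V : normedModType R) (f : V -> R) (x v : V) (k : R) :
  (forall s, `|s| <= `|k| -> derivable f (x + s *: v) v) ->
  exists2 s, `|s| <= `|k| & f (x + k *: v) - f x = k * 'D_v f (x + s *: v).
Proof.
move=> df.
have aux a b : a <= b -> (forall s, a <= s <= b -> `|s| <= `|k|) ->
    exists2 s, `|s| <= `|k| &
      f (x + b *: v) - f (x + a *: v) = (b - a) * 'D_v f (x + s *: v).
  move=> ab abk.
  have dg s : s \in `[a, b]%R ->
      is_derive s 1 (fun s => f (x + s *: v)) ('D_v f (x + s *: v)).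
    by rewrite in_itv => /abk /df /is_derive_line.
  have [s sab ->] := @MVT_segment R (fun s => f (x + s *: v))
      (fun s => 'D_v f (x + s *: v)) a b ab
      (fun s sab => dg s (subset_itv_oo_cc sab))
      (derivable_within_continuous (fun s sab =>
        @ex_derive _ _ _ _ _ _ _ (dg s sab))).
  by exists s; [exact: (abk _ sab)|rewrite mulrC].
have [k0|k0] := leP 0 k.
  have [|s sk] := aux 0 k k0.
    by move=> s /andP[s0 sk]; rewrite !ger0_norm.
  by rewrite scale0r addr0 subr0 => ?; exists s.
have [|s sk] := aux k 0 (ltW k0).
  by move=> s /andP[ks s0]; rewrite !ler0_norm ?lerN2// ltW.
rewrite scale0r addr0 sub0r mulNr => E; exists s => //.
by rewrite -[RHS]opprK -E opprB.
Qed.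

Lemma near_ball_line2 (R : realType) (V : normedModType R) (x v w : V) (P : set V) :
  (\forall z \near x, P z) ->
  \forall h \near (0:R), forall s t, `|s| <= `|h| -> `|t| <= `|h| ->
    P (x + s *: v + t *: w).
Proof.
move=> /nbhs_ballP[e /= e0 eP].
(* The added 1 keeps the constant positive when [v] and [w] both vanish. *)
have c0 : 0 < `|v| + `|w| + 1 by rewrite ltr_wpDl// addr_ge0.
near=> h => s t sh th; apply: eP.
rewrite -ball_normE /ball_/= -addrA opprD addrA subrr sub0r normrN.
apply: (@le_lt_trans _ _ (`|h| * (`|v| + `|w| + 1))).
  rewrite (le_trans (ler_normD _ _))// !normrZ mulrDr mulrDr mulr1.
  by rewrite -[leLHS]addr0 !lerD// ler_wpM2r.
rewrite -ltr_pdivlMr//.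
near: h; apply: (@nbhs0_lt R R^o); exact: divr_gt0.
Unshelve. all: by end_near. Qed.

(* The double difference [f (x+hv+hw) - f (x+hv) - f (x+hw) + f x] is, by two
   applications of the mean value theorem, [h ^ 2] times a value of either mixed
   derivative near [x]. *)
Lemma derive_comm (R : realType) (V : normedModType R) (f : V -> R) (x v w : V) :
  (\forall z \near x, derivable f z v) ->
  (\forall z \near x, derivable f z w) ->
  (\forall z \near x, derivable ('D_v f) z w) ->
  (\forall z \near x, derivable ('D_w f) z v) ->
  {for x, continuous ('D_w ('D_v f))} ->
  {for x, continuous ('D_v ('D_w f))} ->
  'D_w ('D_v f) x = 'D_v ('D_w f) x.
Proof.
move=> dv dw dvw dwv cvw cwv.
(* One order of differentiation suffices: the double difference is symmetric in the two directions,
   so both mixed derivatives get compared with the same quantity. *)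
have half v' w' : (\forall z \near x, derivable f z v') ->
    (\forall z \near x, derivable ('D_v' f) z w') ->
    {for x, continuous ('D_w' ('D_v' f))} ->
    forall e : R, 0 < e -> \forall h \near (0:R),
     `|f (x + h *: v' + h *: w') - f (x + h *: v') - f (x + h *: w') + f x
      - h * h * 'D_w' ('D_v' f) x| <= e * (h * h).
  move=> d1 d2 c e e0.
  have H : \forall z \near x, [/\ derivable f z v', derivable ('D_v' f) z w' &
      `|'D_w' ('D_v' f) x - 'D_w' ('D_v' f) z| <= e].
    by move/cvgrPdist_le: c => /(_ e e0); apply: filterS3 d1 d2 => z ? ? ?; split.
  have H1 := near_ball_line2 v' w' H.
  near=> h.
  have {}H : forall s t : R, `|s| <= `|h| -> `|t| <= `|h| ->
     [/\ derivable f (x + s *: v' + t *: w') v',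
       derivable ('D_v' f) (x + s *: v' + t *: w') w' &
      `|'D_w' ('D_v' f) x - 'D_w' ('D_v' f) (x + s *: v' + t *: w')| <= e].
    by near: h; exact: H1.
  have n0 : `|0 : R| <= `|h| by rewrite normr0.
  have shiftd z : derivable f (z + h *: w') v' ->
      is_derive z v' (fun z => f (z + h *: w')) ('D_v' f (z + h *: w')).
    move=> dz.
    have qE : (fun k : R => k^-1 *: (((fun z => f (z + h *: w')) \o shift z) (k *: v')
        - f (z + h *: w'))) =
      (fun k => k^-1 *: ((f \o shift (z + h *: w')) (k *: v') - f (z + h *: w'))).
      by apply/funext => k /=; rewrite addrA.
    by split; rewrite /derivable ?/derive qE.
  have dphi s : `|s| <= `|h| -> is_derive (x + s *: v') v'
     ((fun z => f (z + h *: w')) - f)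
     ('D_v' f (x + s *: v' + h *: w') - 'D_v' f (x + s *: v')).
    move=> sh; apply: is_deriveB.
      by have [d _ _] := H s h sh (lexx _); exact: shiftd d.
    apply: derivableP; have [+ _ _] := H s 0 sh n0.
    by rewrite scale0r addr0; apply.
  have [s sh] := @MVT_line _ _ ((fun z => f (z + h *: w')) - f) x v' h
     (fun s sh => @ex_derive _ _ _ _ _ _ _ (dphi s sh)).
  rewrite (@derive_val _ _ _ _ _ _ _ (dphi s sh)) => E1.
  have [t th E2] := @MVT_line _ _ ('D_v' f) (x + s *: v') w' h
     (fun t th => let: And3 _ d _ := H s t sh th in d).
  have [_ _ le] := H s t sh th.
  have -> : f (x + h *: v' + h *: w') - f (x + h *: v') - f (x + h *: w') + f x =
     h * h * 'D_w' ('D_v' f) (x + s *: v' + t *: w').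
    by rewrite -mulrA -E2 -E1 !fctE; ring.
  have hh : 0 <= h * h by rewrite -expr2 sqr_ge0.
  rewrite -mulrBr normrM (ger0_norm hh) [leRHS]mulrC; apply: (ler_wpM2l hh).
  by rewrite distrC.
(* Each mixed derivative times [h * h] is within [e / 2 * (h * h)] of the double difference for a
   common small nonzero [h]; dividing by [h * h] bounds their distance by any [e > 0]. *)
apply/eqP; rewrite -subr_eq0 -normr_le0; apply/ler_addgt0Pl => e e0; rewrite addr0.
have e20 : 0 < e / 2 by rewrite divr_gt0.
have h1 := half v w dv dvw cvw _ e20.
have h2 := half w v dw dwv cwv _ e20.
have [h [[h0 {}h1] {}h2]] := filter_ex (filterI (filterI
  (nbhs_dnbhs_neq (0 : R)) (nbhs_dnbhs h1)) (nbhs_dnbhs h2)).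
have hh0 : 0 < h * h by rewrite lt_neqAle eq_sym mulf_neq0//= -expr2 sqr_ge0.
rewrite (addrAC x) in h2.
rewrite -(ler_pM2l hh0) -{1}(gtr0_norm hh0) -normrM mulrBr.
move: h1 h2; set P := f (x + _ + _); set A := f _; set B := f _.
move: (f x) ('D_w _ _) ('D_v _ _) => C X Y.
set H := h * h; rewrite !ler_norml => /andP[? ?] /andP[? ?].
by apply/andP; split; lra.
Unshelve. all: by end_near. Qed.

Lemma cvg_sum (R : realType) (W : normedModType R) (T I : Type) (r : seq I)
    (F : set_system T) {FF : Filter F} (f : I -> T -> W) (l : I -> W) :
  (forall i, f i @ F --> l i) ->
  (fun x => \sum_(i <- r) f i x) @ F --> \sum_(i <- r) l i.
Proof.
move=> fl; elim: r => [|i r IH].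
  by rewrite big_nil; under eq_fun do rewrite big_nil; exact: cvg_cst.
rewrite big_cons; under eq_fun do rewrite big_cons.
exact: cvgD (fl i) IH.
Qed.

(** The form of continuous differentiability that the chain rule consumes: partial derivatives along
    the basis exist near [y], and are continuous at [y] itself. *)
Definition C1_at (R : realType) (n : nat) (f : 'rV[R]_n -> R) (y : 'rV[R]_n) :=
  forall j, (\forall z \near y, derivable f z (delta_mx 0 j)) /\
    {for y, continuous ('D_(delta_mx 0 j) f)}.

(* Reach [y + k] from [y] by changing one coordinate at a time, and apply the mean
   value theorem to each step. *)
Lemma C1_estimate (R : realType) (n : nat) (f : 'rV[R]_n -> R) (y : 'rV[R]_n) :
  C1_at f y -> forall e : R, 0 < e -> \forall k \near (0 : 'rV[R]_n),
    `|f (y + k) - f y - \sum_j k 0 j * 'D_(delta_mx 0 j) f y| <= e * `|k|.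
Proof.
(* Each of the [n] coordinate steps will cost at most [e' * |k|]. Dividing by [n.+1] also covers
   dimension 0. *)
move=> C1 e e0; pose e' := e / n.+1%:R.
have e'0 : 0 < e' by rewrite divr_gt0.
have H : \forall z \near y, forall j, derivable f z (delta_mx 0 j) /\
      `|'D_(delta_mx 0 j) f z - 'D_(delta_mx 0 j) f y| <= e'.
  pose Q (j : 'I_n) (z : 'rV[R]_n) := derivable f z (delta_mx 0 j) /\
      `|'D_(delta_mx 0 j) f z - 'D_(delta_mx 0 j) f y| <= e'.
  apply: (@filter_forall _ _ Q (nbhs y)) => j.
  have [d /cvgrPdist_le/(_ e' e'0) c] := C1 j.
  by apply: filterS2 d c => z ? ?; split; rewrite // distrC.
have [r /= r0 {}H] := (nbhs_ballP _ _).1 H.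
near=> k.
have kr : `|k| < r by near: k; exact: (@nbhs0_lt _ 'rV[R]_n).
have normE (z : 'rV[R]_n) : `|z| = mx_norm z by [].
have kj j : `|k 0 j| <= `|k|.
  rewrite [leRHS]normE mx_normrE.
  exact: (le_bigmax _ (fun ij : 'I_1 * 'I_n => `|k ij.1 ij.2|) (0, j)).
(* [p m] keeps the first [m] coordinates of [k], so the path runs from [p 0 = 0] to [p n = k]. *)
pose p m : 'rV[R]_n := \row_j (if (j < m)%N then k 0 j else 0).
have pS (m : 'I_n) : p m.+1 = p m + k 0 m *: delta_mx 0 m.
  apply/rowP => j; rewrite !mxE eqxx /= ltnS leq_eqVlt -val_eqE /=.
  by case: eqP => [/val_inj->|_] /=; rewrite ?ltnn ?mulr1 ?add0r ?mulr0 ?addr0.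
have p0 : p 0%N = 0 by apply/rowP => j; rewrite !mxE ltn0.
have pn : p n = k by apply/rowP => j; rewrite !mxE ltn_ord.
(* The norm is the maximum norm, so changing coordinates one at a time never leaves the ball of
   radius [r]. *)
have pr (m : 'I_n) s : `|s| <= `|k 0 m| -> ball y r (y + p m + s *: delta_mx 0 m).
  move=> sk; rewrite -ball_normE /ball_/= -addrA opprD addrA subrr sub0r normrN.
  apply: le_lt_trans kr; rewrite [leLHS]normE mx_normrE; apply: bigmax_le => // -[i j] _.
  rewrite !mxE /= (ord1 i) eqxx /=; case: eqP => [->|_].
    by rewrite ltnn add0r mulr1 (le_trans sk).
  by rewrite mulr0 addr0; case: ifP => _; rewrite ?normr0.
have step (m : 'I_n) : exists2 d, `|d - 'D_(delta_mx 0 m) f y| <= e' &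
    f (y + p m.+1) - f (y + p m) = k 0 m * d.
  have [s sk E] := @MVT_line _ _ f (y + p m) (delta_mx 0 m) (k 0 m)
     (fun s sk => (H _ (pr m s sk) m).1).
  exists ('D_(delta_mx 0 m) f (y + p m + s *: delta_mx 0 m)).
    exact: (H _ (pr m s sk) m).2.
  by rewrite pS addrA.
have -> : f (y + k) - f y = \sum_(m < n) (f (y + p m.+1) - f (y + p m)).
  rewrite -(big_mkord xpredT (fun m => f (y + p m.+1) - f (y + p m))).
  by rewrite (telescope_sumr (fun m => f (y + p m)))// pn p0 addr0.
rewrite -sumrB (le_trans (ler_norm_sum _ _ _))//.
have -> : e = e' * n.+1%:R by rewrite /e' divfK.
apply: (@le_trans _ _ (\sum_(m < n) e' * `|k|)).
  apply: ler_sum => m _; have [d dy ->] := step m.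
  by rewrite -mulrBr normrM mulrC ler_pM.
rewrite sumr_const card_ord -[leLHS]mulr_natr mulrAC.
by apply: ler_wpM2r => //; apply: ler_wpM2l; rewrite ?ler_nat// ltW.
Unshelve. all: by end_near. Qed.

(* The curve [c] is followed along an arbitrary filter [F] of increments so that
   one-sided derivatives are covered. *)
Lemma cvg_chain (R : realType) (n : nat) (f : 'rV[R]_n -> R) (y w : 'rV[R]_n)
    (F : set_system R) {FF : Filter F} (c : R -> 'rV[R]_n) :
  C1_at f y -> F `=>` 0^' ->
  (fun h => h^-1 *: (c h - y)) @ F --> w ->
  (fun h => h^-1 *: (f (c h) - f y)) @ F -->
    \sum_j w 0 j * 'D_(delta_mx 0 j) f y.
Proof.
move=> C1 F0 qw.
set D := fun j => 'D_(delta_mx 0 j) f y.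
pose q h := h^-1 *: (c h - y).
have qw' : q @ F --> w by exact: qw.
have Fid : id @ F --> (0 : R) by move=> A /nbhs_dnbhs /F0.
have F_neq0 : \forall h \near F, h != 0 by exact: (F0 _ (nbhs_dnbhs_neq (0 : R))).
have cE : \forall h \near F, c h - y = h *: q h.
  by apply: filterS F_neq0 => h h0; rewrite scalerA divff// scale1r.
have c0 : (fun h => h *: q h) @ F --> (0 : 'rV[R]_n).
  by rewrite -[X in _ --> X](scale0r w); exact: cvgZ.
have Lq : (fun h => \sum_j q h 0 j * D j) @ F --> \sum_j w 0 j * D j.
  by apply: cvg_sum => j; exact: cvgMr_tmp ((mx_cvgP q w).1 qw' 0 j).
pose L h := \sum_j q h 0 j * D j.
pose r h := h^-1 *: (f (c h) - f y) - L h.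
(* The linear part of the quotient already has the desired limit, so only the remainder must be
   shown to vanish. *)
suff r0 : r @ F --> (0 : R).
  rewrite (_ : (fun h => _) = r + L); last by apply/funext => h; rewrite !fctE subrK.
  by rewrite -[X in _ --> X]add0r; exact: cvgD r0 Lq.
have w1 : 0 < `|w| + 1 by rewrite ltr_wpDl.
have qb : \forall h \near F, `|q h| <= `|w| + 1.
  have qn : (fun h => `|q h|) @ F --> `|w| by exact: cvg_norm.
  move/cvgrPdist_le: qn => /(_ 1 ltr01).
  apply: filterS => h; rewrite distrC => /(le_trans (ler_norm _)).
  by rewrite lerBlDl.
apply/cvgrPdist_le => e e0.
(* Since [q h] is bounded by [|w| + 1] along [F], this constant turns the error in the increment
   [h *: q h] into at most [e * |h|]. *)
have e'0 : 0 < e / (`|w| + 1) by rewrite divr_gt0.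
have est := c0 _ (C1_estimate C1 e'0).
apply: filterS (filterI (filterI F_neq0 cE) (filterI qb est)).
move=> h [[h0 ch] [qh +]]; rewrite /= -ch [y + _]addrC subrK => le.
rewrite sub0r normrN /r /L.
have hn : 0 < `|h| by rewrite normr_gt0.
rewrite -(ler_pM2l hn) -normrM mulrBr mulr_sumr {1}/GRing.scale/= mulrA divff// mul1r.
have -> : \sum_j h * (q h 0 j * D j) = \sum_j (c h - y) 0 j * D j.
  by apply: eq_bigr => j _; rewrite ch mulrA [in RHS]mxE.
apply: le_trans le _.
rewrite ch normrZ mulrCA ler_wpM2l//.
by rewrite mulrAC ler_pdivrMr// ler_wpM2l// ltW.
Qed.

(** * Bilinear forms and Christoffel symbols *)

Section Bilin.
Context {R : realType} {n : nat}.
Implicit Types (A B : 'M[R]_n) (v w : 'rV[R]_n).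

Lemma bilinE A v w : bilin A v w = \sum_i \sum_j v 0 i * A i j * w 0 j.
Proof.
rewrite /bilin mxE exchange_big /=; apply: eq_bigr => j _.
by rewrite !mxE mulr_suml.
Qed.

Lemma bilinC A v w : A^T = A -> bilin A v w = bilin A w v.
Proof.
move=> As; rewrite /bilin -[in LHS]As -mulmxA -trmx_mul -[X in X *m _]trmxK.
by rewrite -trmx_mul mxE.
Qed.

Lemma bilinDl A v v' w : bilin A (v + v') w = bilin A v w + bilin A v' w.
Proof. by rewrite /bilin !mulmxDl mxE. Qed.

Lemma bilinNl A v w : bilin A (- v) w = - bilin A v w.
Proof. by rewrite /bilin !mulNmx mxE. Qed.

Lemma is_derive_bilin (V : normedModType R) (A : V -> 'M[R]_n)
    (X Y : V -> 'rV[R]_n) (p z : V)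
    (dA : 'M[R]_n) (dX dY : 'rV[R]_n) :
  (forall a b, is_derive p z (fun q => A q a b) (dA a b)) ->
  (forall a, is_derive p z (fun q => X q 0 a) (dX 0 a)) ->
  (forall a, is_derive p z (fun q => Y q 0 a) (dY 0 a)) ->
  is_derive p z (fun q => bilin (A q) (X q) (Y q))
    (bilin dA (X p) (Y p) + bilin (A p) dX (Y p) + bilin (A p) (X p) dY).
Proof.
move=> hA hX hY.
rewrite (_ : (fun q => _) = \sum_(i < n) \sum_(j < n)
   ((fun q => X q 0 i) * (fun q => A q i j) * (fun q => Y q 0 j))); last first.
  apply/funext => q; rewrite bilinE fct_sumE; apply: eq_bigr => i _.
  by rewrite fct_sumE.
rewrite !bilinE -!big_split /=.
apply: is_derive_sum => i; rewrite -!big_split /=; apply: is_derive_sum => j.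
apply: is_derive_eq; rewrite /GRing.scale /= fctE.
ring.
Qed.

Lemma cvg_bilin (T : Type) (F : set_system T) {FF : Filter F} (A : T -> 'M[R]_n)
    (X Y : T -> 'rV[R]_n) A0 X0 Y0 :
  A @ F --> A0 -> X @ F --> X0 -> Y @ F --> Y0 ->
  (fun q => bilin (A q) (X q) (Y q)) @ F --> bilin A0 X0 Y0.
Proof.
move=> hA hX hY; rewrite bilinE; under eq_fun do rewrite bilinE.
apply: cvg_sum => i; apply: cvg_sum => j.
apply: cvgM; last exact: (mx_cvgP _ _).1 hY 0 j.
by apply: cvgM; [exact: (mx_cvgP _ _).1 hX 0 i|exact: (mx_cvgP _ _).1 hA i j].
Qed.

(** A nonzero row [v] of the left kernel would satisfy [v *m A = 0], hence [bilin A v v = 0],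
    against positivity. *)
Lemma posdef_unitmx A : (forall v, v != 0 -> 0 < bilin A v v) -> A \in unitmx.
Proof.
move=> Apos; rewrite -row_free_unit -kermx_eq0; apply/eqP/row_matrixP => i.
rewrite row0; apply/eqP/negPn/negP => v0.
have := Apos _ v0; rewrite /bilin.
have /sub_kermxP -> := row_sub i (kermx A).
by rewrite mul0mx mxE ltxx.
Qed.

(* In coordinates, [g(Gamma(X, X), Z)] is [(D_X g)(X, Z) - 1/2 (D_Z g)(X, X)]. *)
Lemma bilin_christoffel (G : 'M[R]_n) (dG : 'I_n -> 'M[R]_n) (X Z : 'rV[R]_n) :
  G \in unitmx -> G^T = G -> (forall c, (dG c)^T = dG c) ->
  bilin G (\row_k \sum_a \sum_b
    (2^-1 * \sum_l invmx G k l * (dG a b l + dG b a l - dG l a b)) *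
    (X 0 a * X 0 b)) Z =
  bilin (\sum_c X 0 c *: dG c) X Z - 2^-1 * bilin (\sum_c Z 0 c *: dG c) X X.
Proof.
move=> Gu Gs dGs.
(* [S] is the contraction with the symbols of the first kind. The Christoffel contraction is [S]
   times the inverse metric, which cancels against [G]. *)
pose S := \row_l \sum_a \sum_b
   (2^-1 * (dG a b l + dG b a l - dG l a b)) * (X 0 a * X 0 b).
rewrite (_ : (\row_k _) = S *m (invmx G)^T); last first.
  apply/rowP => k; rewrite !mxE.
  under [RHS]eq_bigr => l _ do (rewrite !mxE mulr_suml;
    under eq_bigr => a _ do rewrite mulr_suml).
  rewrite [RHS]exchange_big; apply: eq_bigr => a _ /=.
  rewrite [RHS]exchange_big; apply: eq_bigr => b _ /=.
  rewrite mulr_sumr mulr_suml; apply: eq_bigr => l _; ring.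
rewrite {1}/bilin trmx_inv Gs mulmxKV// mxE.
have -> : bilin (\sum_c X 0 c *: dG c) X Z =
    \sum_l (\sum_a \sum_b X 0 a * X 0 b * dG a b l) * Z 0 l.
  rewrite bilinE exchange_big; apply: eq_bigr => l _ /=.
  rewrite [in RHS]exchange_big /= mulr_suml; apply: eq_bigr => b _.
  rewrite summxE mulr_sumr !mulr_suml; apply: eq_bigr => a _.
  rewrite mxE; ring.
have -> : bilin (\sum_c Z 0 c *: dG c) X X =
    \sum_l (\sum_a \sum_b X 0 a * X 0 b * dG l a b) * Z 0 l.
  rewrite bilinE.
  under [RHS]eq_bigr => l _ do (rewrite mulr_suml;
    under eq_bigr => a _ do rewrite mulr_suml).
  rewrite [RHS]exchange_big; apply: eq_bigr => a _ /=.
  rewrite [RHS]exchange_big; apply: eq_bigr => b _ /=.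
  rewrite summxE mulr_sumr mulr_suml; apply: eq_bigr => l _; rewrite mxE; ring.
rewrite mulr_sumr -sumrB; apply: eq_bigr => l _.
rewrite !mxE mulrA -mulrBl; congr (_ * _).
(* Since [X 0 a * X 0 b] is symmetric, exchanging [a] and [b] shows that the first two terms of the
   symbol contribute equally. *)
set P := \sum_a \sum_b _ * dG a b l.
have PE : P = \sum_a \sum_b X 0 a * X 0 b * dG b a l.
  by rewrite /P exchange_big; apply: eq_bigr => a _; apply: eq_bigr => b _; ring.
have -> : P = 2^-1 * (P + \sum_a \sum_b X 0 a * X 0 b * dG b a l).
  by rewrite -PE; field.
rewrite /P -mulrBr -big_split -sumrB mulr_sumr /=; apply: eq_bigr => a _.
rewrite -big_split -sumrB mulr_sumr /=; apply: eq_bigr => b _; ring.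
Qed.

End Bilin.

Lemma is_derive_mx_comp (R : realType) (V : normedModType R) (m k n : nat)
    (g : 'rV[R]_n -> 'M[R]_(m, k)) (f : V -> 'rV[R]_n) (p z : V) (w : 'rV[R]_n) :
  (forall a b, C1_at (fun y => g y a b) (f p)) -> is_derive p z f w ->
  forall a b, is_derive p z (fun q => g (f q) a b)
    (\sum_c w 0 c * 'D_(delta_mx 0 c) (fun y => g y a b) (f p)).
Proof.
move=> gC1 [df wE] a b.
have fw : (fun h => h^-1 *: (f (h *: z + p) - f p)) @ 0^' --> w by rewrite -wE; exact: df.
have gw := cvg_chain (gC1 a b) (fun A => id) fw.
by split; [apply/cvg_ex; eexists; exact: gw|by apply: cvg_lim => //; exact: gw].
Qed.

(** The pointwise algebra behind the Cauchy-Riemann equations. [D Z X Y dX dY] is the product-rule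
    derivative along [Z] of [g(X, Y)], with [dX] and [dY] the derivatives of [X] and [Y]; [us]
    stands for the angular derivative. A single [uts] encodes the symmetry of mixed derivatives. The
    identities come from pairing the vanishing tension with [ut] and with [us]. *)
Lemma conformal_identities (R : realType) (n : nat) (G : 'M[R]_n)
    (dG : 'I_n -> 'M[R]_n) (ut us utt uss uts : 'rV[R]_n) :
  G \in unitmx -> G^T = G -> (forall c, (dG c)^T = dG c) ->
  utt + uss + \row_k \sum_a \sum_b
    (2^-1 * \sum_l invmx G k l * (dG a b l + dG b a l - dG l a b)) *
    (ut 0 a * ut 0 b + us 0 a * us 0 b) = 0 ->
  let D Z X Y dX dY := bilin (\sum_c (Z : 'rV_n) 0 c *: dG c) X Y +
    bilin G dX Y + bilin G X dY in
  D ut ut ut utt utt - D ut us us uts uts = - (2 * D us ut us uts uss) /\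
  2 * D ut ut us utt uts = D us ut ut uts uts - D us us us uss uss.
Proof.
move=> Gu Gs dGs ten D.
pose Gam (X : 'rV_n) := \row_k \sum_a \sum_b
    (2^-1 * \sum_l invmx G k l * (dG a b l + dG b a l - dG l a b)) *
    (X 0 a * X 0 b).
(* The Christoffel term of the tension splits into a quadratic term in [ut] and one in [us], to each
   of which [bilin_christoffel] applies. *)
have lap Z : bilin G utt Z + bilin G uss Z = - (bilin G (Gam ut) Z + bilin G (Gam us) Z).
  rewrite -!bilinDl -bilinNl; congr (bilin _ _ _).
  apply/eqP; rewrite -addr_eq0 -ten; apply/eqP; congr (_ + _).
  apply/rowP => k; rewrite !mxE -big_split /=; apply: eq_bigr => a _.
  by rewrite -big_split /=; apply: eq_bigr => b _; rewrite mulrDr.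
have dMs (Z : 'rV_n) : (\sum_c Z 0 c *: dG c)^T = \sum_c Z 0 c *: dG c.
  by rewrite linear_sum; apply: eq_bigr => c _; rewrite linearZ /= dGs.
have := lap ut; have := lap us; rewrite !bilin_christoffel// /D.
(* Once every pairing is written in one order, the claims are linear consequences of the two paired
   equations. *)
rewrite (bilinC ut utt)// (bilinC us uts)// (bilinC ut uss)// (bilinC ut uts)//.
rewrite (bilinC us uss)// !(bilinC us ut)//.
set M1 := \sum_c ut 0 c *: dG c; set M2 := \sum_c us 0 c *: dG c.
move=> h1 h2; split; lra.
Qed.

(** * Integrals over circles *)

(** Supplies the constant dominating functions for limits and derivatives under the integral
    sign. *)
Lemma compact_norm_bound (R : realType) (V : topologicalType) (K : set V) (f : V -> R) :
  compact K -> {within K, continuous f} ->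
  exists2 C, 0 <= C & forall x, K x -> `|f x| <= C.
Proof.
move=> cK cf.
have [C [_ HC]] := @compact_bounded R R^o _ (continuous_compact cf cK).
exists (`|C| + 1); first exact: addr_ge0.
move=> x Kx; apply: (HC (`|C| + 1)); last by exists x.
by rewrite (le_lt_trans (ler_norm _))// ltrDl.
Qed.

Lemma pair_lineE (R : realType) (t x : R) :
  ((t, x) = (0, x) + t *: @d_t R) * ((t, x) = (t, 0) + x *: @d_theta R).
Proof.
have ZE (a : R) (v : R * R) : a *: v = (a * v.1, a * v.2) by [].
have DE (v w : R * R) : v + w = (v.1 + w.1, v.2 + w.2) by [].
by rewrite !ZE !DE /= !mulr1 !mulr0 !addr0 !add0r.
Qed.

Lemma is_derive_pair (R : realType) (f : R * R -> R) (t x : R) :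
  (derivable f (t, x) (@d_t R) ->
    is_derive t 1 (fun t => f (t, x)) ('D_(@d_t R) f (t, x))) *
  (derivable f (t, x) (@d_theta R) ->
    is_derive x 1 (fun x => f (t, x)) ('D_(@d_theta R) f (t, x))).
Proof.
split.
  rewrite (pair_lineE t x).1 => /is_derive_line.
  by under eq_fun do rewrite -(pair_lineE _ x).1.
rewrite (pair_lineE t x).2 => /is_derive_line.
by under eq_fun do rewrite -(pair_lineE t _).2.
Qed.

Lemma pair_continuous (U V : topologicalType) (t : U) (x : V) :
  {for t, continuous (fun t => (t, x))} * {for x, continuous (fun x => (t, x))}.
Proof.
split.
  have c : (fun=> x) @ t --> x by exact: cvg_cst.
  exact: (cvg_pair (@cvg_id _ (nbhs t)) c).
have c : (fun=> t) @ x --> t by exact: cvg_cst.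
exact: (cvg_pair c (@cvg_id _ (nbhs x))).
Qed.

(** * Conservation of a circle integral whose density has a periodic angular primitive for its
    t-derivative *)

Section Conservation.
Context {R : realType}.
Variables (T1 T2 : R) (E M : R * R -> R).
Hypothesis T12 : T1 < T2.
Hypothesis cE : {within strip T1 T2, continuous E}.
Hypothesis dE : forall p : R * R, T1 < p.1 < T2 ->
  derivable E p (@d_t R) /\ {for p, continuous ('D_(@d_t R) E)}.
Hypothesis dM : forall p : R * R, T1 < p.1 < T2 ->
  is_derive p (@d_theta R) M ('D_(@d_t R) E p).
Hypothesis perM : forall t, T1 < t < T2 -> M (t, 2 * pi) = M (t, 0).

Let B : set R := `[0, 2 * pi].
Let F t := \int[lebesgue_measure]_(x in B) E (t, x).

(** The retraction of the line onto [[T1, T2]]. Composing with it, as [Ec] does, extends [E]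
    continuously to the whole plane, so that [T1] and [T2] become interior points for continuity
    under the integral. *)
Let clamp (t : R) : R := Num.max T1 (Num.min T2 t).

Let clamp_id t : T1 <= t <= T2 -> clamp t = t.
Proof. by move=> /andP[? ?]; rewrite /clamp min_r// max_r. Qed.

Let clamp_in t : T1 <= clamp t <= T2.
Proof. by rewrite /clamp le_max lexx /= ge_max (ltW T12) /= ge_min lexx. Qed.

Let clamp_cont : continuous clamp.
Proof.
move=> t; apply: (@continuous_max R R (cst T1) (fun t => Num.min T2 t)).
  exact: cst_continuous.
apply: (@continuous_min R R (cst T2) id); first exact: cst_continuous.
exact: cvg_id.
Qed.

Let Ec (p : R * R) := E (clamp p.1, p.2).

Let Ec_cont : continuous Ec.
Proof.
move=> p.
have c1 : {for p, continuous (fun q : R * R => clamp q.1)}.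
  apply: (@continuous_comp _ _ _ fst clamp); [exact: cvg_fst|exact: clamp_cont].
have c2 : {for p, continuous (fun q : R * R => q.2)} by exact: cvg_snd.
have cp : (fun q : R * R => (clamp q.1, q.2)) @ p --> (clamp p.1, p.2).
  exact: (cvg_pair c1 c2).
have cEp := (subspace_continuousP _ _).1 cE (clamp p.1, p.2) (clamp_in p.1).
apply: (cvg_trans _ cEp) => A wA.
have {}wA : \forall q \near (clamp p.1, p.2), strip T1 T2 q -> A (E q) by exact: wA.
have ccA : \forall q \near p, strip T1 T2 (clamp q.1, q.2) -> A (Ec q) by exact: cp _ wA.
have : \forall q \near p, A (Ec q).
  by apply: filterS ccA => q; apply; exact: clamp_in.
by [].
Qed.

Let cpt_B : compact B. Proof. exact: segment_compact. Qed.

Let int_slice (f : R * R -> R) t : {in B, forall x, {for (t, x), continuous f}} ->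
  {within B, continuous (fun x => f (t, x))}.
Proof.
move=> cf; apply: continuous_in_subspaceT => x Bx.
apply: (@continuous_comp _ _ _ (fun x => (t, x)) f); last exact: cf.
exact: (pair_continuous t x).2.
Qed.

Let intEc t : lebesgue_measure.-integrable B (EFin \o (fun x => Ec (t, x))).
Proof.
apply: continuous_compact_integrable => //.
by apply: int_slice => x _; exact: Ec_cont.
Qed.

Let intB_cst (C : R) : lebesgue_measure.-integrable B (EFin \o cst C).
Proof.
by apply: continuous_compact_integrable => //; apply: continuous_subspaceT => ?; exact: cvg_cst.
Qed.

Let F_cont : {within `[T1, T2], continuous F}.
Proof.
pose Fc t := \int[lebesgue_measure]_(x in B) Ec (t, x).
have FE t : T1 <= t <= T2 -> F t = Fc t.
  by move=> tT; apply: eq_Rintegral => x _; rewrite /Ec /= clamp_id.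
suff cF : {within `[T1, T2], continuous Fc}.
  apply/subspace_continuousP => t tT.
  suff : F @ within `[T1, T2] (nbhs t) --> F t by [].
  rewrite FE//; apply: cvg_trans ((subspace_continuousP _ _).1 cF t tT).
  apply: near_eq_cvg; rewrite /prop_near1 /within /=.
  by apply: nearW => s sT; rewrite FE.
(* Widening the interval by 1 on each side puts all of [[T1, T2]] inside an open interval over which
   [C] dominates [Ec]. *)
have [C C0 HC] := compact_norm_bound
  (compact_setX (@segment_compact R (T1 - 1) (T2 + 1)) cpt_B)
  (continuous_subspaceT Ec_cont).
apply: continuous_in_subspaceT => t /set_mem /= tT.
have mB : measurable B by exact: measurable_itv.
have i1 (s : R) : `]T1 - 1, T2 + 1[%classic s ->
    lebesgue_measure.-integrable B (EFin \o (fun x => Ec (s, x))).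
  by move=> _; exact: intEc.
have i2 : {ae lebesgue_measure, forall x, B x ->
    {in `]T1 - 1, T2 + 1[%classic, continuous ((fun t x => Ec (t, x)) ^~ x)}}.
  apply: aeW => x Bx s _.
  apply: (@continuous_comp _ _ _ (fun t => (t, x)) Ec); last exact: Ec_cont.
  exact: (pair_continuous s x).1.
have i3 (s : R) : `]T1 - 1, T2 + 1[%classic s -> {ae lebesgue_measure, forall x, B x ->
    `|Ec (s, x)| <= cst C x}.
  move=> sI; apply: aeW => x Bx; apply: HC; split => //=.
  exact: subset_itv_oo_cc.
have tI : t \in `]T1 - 1, T2 + 1[%classic; last first.
  exact: (@continuity_under_integral R _ _ lebesgue_measure (fun t x => Ec (t, x))
    B mB (T1 - 1) (T2 + 1) i1 i2 (cst C) (intB_cst C) i3 t tI).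
rewrite inE /=; move: tT; rewrite !in_itv /= => /andP[? ?]; apply/andP; split; lra.
Qed.

(** Differentiation under the integral gives the integral of the t-derivative of [E], which is the
    theta-derivative of [M]. The fundamental theorem of calculus leaves [M (a, 2 * pi) - M (a, 0)],
    zero by periodicity. *)
Let F_derive a : T1 < a < T2 -> is_derive a 1 F 0.
Proof.
move=> /andP[T1a aT2].
(* Midpoints between [a] and the two ends: [[u0, v0]] is compact inside the open interval, so the
   t-derivative of [E] is bounded over it. *)
pose u0 := (T1 + a) / 2; pose v0 := (T2 + a) / 2.
have Hin t : t \in `[u0, v0]%R -> T1 < t < T2.
  by rewrite in_itv /u0 /v0 /= => /andP[? ?]; apply/andP; split; lra.
have aI : a \in `]u0, v0[%R.
  by rewrite in_itv /u0 /v0 /=; apply/andP; split; lra.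
have dEc : {within `[u0, v0] `*` B, continuous ('D_(@d_t R) E)}.
  apply: continuous_in_subspaceT => -[t x] /set_mem[/= tI _].
  exact: (dE (p := (t, x)) (Hin t tI)).2.
have [C C0 HC] := compact_norm_bound (compact_setX (@segment_compact R u0 v0) cpt_B) dEc.
have ders t x : t \in `[u0, v0]%R ->
    is_derive t 1 (fun t => E (t, x)) ('D_(@d_t R) E (t, x)).
  by move=> tI; apply: (is_derive_pair E t x).1; exact: (dE (p := (t, x)) (Hin t tI)).1.
have H1 : forall t, `]u0, v0[%classic t ->
    lebesgue_measure.-integrable B (EFin \o (fun x => E (t, x))).
  move=> t tI; have := intEc t; rewrite /Ec /= clamp_id//.
  by have /andP[/ltW -> /ltW ->] := Hin t (subset_itv_oo_cc tI).
have H2 : forall t x, `]u0, v0[%classic t -> B x -> derivable (fun t => E (t, x)) t 1.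
  by move=> t x tI _; exact: @ex_derive _ _ _ _ _ _ _ (ders t x (subset_itv_oo_cc tI)).
have H3 : forall t x, `]u0, v0[%classic t -> B x ->
    `|partial1of2 (fun t x => E (t, x)) t x| <= cst C x.
  move=> t x tI Bx; rewrite partial1of2E.
  rewrite (@derive_val _ _ _ _ _ _ _ (ders t x (subset_itv_oo_cc tI))).
  by apply: HC; split => //; exact: subset_itv_oo_cc.
have mB : measurable B by exact: measurable_itv.
split.
  exact: (@derivable_under_integral R _ _ lebesgue_measure (fun t x => E (t, x))
    B mB a u0 v0 aI H1 H2 (cst C) (fun=> C0) (intB_cst C) H3).
have := @differentiation_under_integral R _ _ lebesgue_measure (fun t x => E (t, x))
    B mB a u0 v0 aI H1 H2 (cst C) (fun=> C0) (intB_cst C) H3.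
rewrite derive1E => ->.
under eq_Rintegral => x _ do rewrite partial1of2E
  (@derive_val _ _ _ _ _ _ _ (ders a x (subset_itv_oo_cc aI))).
have aT : T1 < a < T2 by rewrite T1a.
have dMa (x : R) : is_derive x 1 (fun x : R => M (a, x)) ('D_(@d_t R) E (a, x)).
  have [d <-] := dM (p := (a, x)) aT.
  exact: (is_derive_pair M a x).2.
have cMa : continuous (fun x => M (a, x)).
  move=> x; apply/differentiable_continuous/derivable1_diffP.
  exact: @ex_derive _ _ _ _ _ _ _ (dMa x).
rewrite /Rintegral (@continuous_FTC2 R (fun x => 'D_(@d_t R) E (a, x)) (fun x => M (a, x))).
- by rewrite perM// -EFinB subrr.
- by rewrite mulr_gt0// pi_gt0.
- by apply: (@int_slice ('D_(@d_t R) E) a) => x _; exact: (dE (p := (a, x)) aT).2.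
- split; first by move=> x _; exact: @ex_derive _ _ _ _ _ _ _ (dMa x).
  + by apply: cvg_at_right_filter; exact: cMa.
  + by apply: cvg_at_left_filter; exact: cMa.
- by move=> x _; rewrite derive1E (@derive_val _ _ _ _ _ _ _ (dMa x)).
Qed.

(** The mean value theorem with zero derivative. It asks for derivatives only strictly between the
    endpoints, where [F_derive] holds, and for continuity up to them, given by [F_cont]. *)
Lemma conserved_integral t t' : T1 <= t <= T2 -> T1 <= t' <= T2 ->
  \int[lebesgue_measure]_(x in `[0, 2 * pi]) E (t, x) =
  \int[lebesgue_measure]_(x in `[0, 2 * pi]) E (t', x).
Proof.
wlog tt' : t t' / t <= t' => [H tT t'T|].
  by have /orP[] := le_total t t' => ?; [exact: H|symmetry; exact: H].
move=> /andP[T1t _] /andP[_ t'T2].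
have [||c _] := @MVT_segment R F (fun=> 0) t t' tt'.
- by move=> x; rewrite in_itv => /= /andP[? ?]; apply: F_derive; apply/andP; split; lra.
- by apply: continuous_subspaceW F_cont; apply: subset_itv; rewrite bnd_simp.
- by rewrite mul0r => /subr0_eq.
Qed.

End Conservation.

(** * Changes of chart on the closed cylinder *)

Lemma cvg_near_eq (T : Type) (U : topologicalType) (F : set_system T)
    {FF : Filter F} (f g : T -> U) (l : U) :
  (\forall x \near F, f x = g x) -> g @ F --> l -> f @ F --> l.
Proof.
by move=> fg gl A Al; apply: filterS2 fg (gl A Al) => x; rewrite /preimage/= => ->.
Qed.

Section DerivativeWithin.
Context {R : realType} {V W : normedModType R}.

Lemma near_shift_line (D : set V) (x v : V) : (\forall q \near x, D q) ->
  \forall h \near (0 : R)^', D (shift x (h *: v)).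
Proof.
move=> Dx; apply: nbhs_dnbhs.
have c0 : {for (0 : R), continuous (fun h : R => shift x (h *: v))}.
  apply: (@continuousD _ _ _ (fun h : R => h *: v) (cst x)).
    exact: scalel_continuous.
  exact: cst_continuous.
by apply: c0; rewrite /= scale0r add0r.
Qed.

(** At an interior point of [D] every small increment is admissible, so the restricted quotient is
    the ordinary one. [D] is only a neighbourhood of [x] because a chart preimage may contain
    boundary points of the strip. *)
Lemma is_derive_in (D : set V) (f : V -> W) (x v : V) :
  (\forall q \near x, D q) -> derivable_in D f x v ->
  is_derive x v f (derive_in D f v x).
Proof.
move=> Dx; rewrite /derivable_in /derive_in => df.
have qE : quotient_in D f x v =
    (fun h : R => h^-1 *: ((f \o shift x) (h *: v) - f x)) @ 0^'.
  apply/seteqP; split=> A; last exact: cvg_within.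
  by move=> wA; apply: filterS2 (near_shift_line v Dx) wA => h Dh; apply.
by move: df; rewrite qE; split.
Qed.

End DerivativeWithin.

Lemma smooth_C1_at (R : realType) (m k n : nat) (D : set 'rV[R]_n)
    (g : 'rV[R]_n -> 'M[R]_(m, k)) (y : 'rV[R]_n) :
  open D -> smooth D g -> D y -> forall a b, C1_at (fun y => g y a b) y.
Proof.
move=> oD /(_ 1%N)[_ sg] Dy a b j.
have nD z : D z -> \forall q \near z, D q by move=> Dz; exact: open_nbhs_nbhs.
have [dg [cg _]] := sg (delta_mx 0 j).
have dgz z : D z -> derivable g z (delta_mx 0 j).
  by move=> Dz; have [] := is_derive_in (nD z Dz) (dg z Dz).
have dgE z : D z -> 'D_(delta_mx 0 j) (fun y => g y a b) z =
    derive_in D g (delta_mx 0 j) z a b.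
  move=> Dz; have [_ <-] := is_derive_in (nD z Dz) (dg z Dz).
  by rewrite derive_mx ?mxE//; exact: dgz.
split.
  by apply: filterS (nD y Dy) => z Dz; exact: ((derivable_mxP _ _ _).1 (dgz z Dz)).
have c1 : derive_in D g (delta_mx 0 j) @ y --> derive_in D g (delta_mx 0 j) y.
  by move: cg; rewrite continuous_open_subspace// => /(_ y); apply; rewrite inE.
have c2 : (fun z => derive_in D g (delta_mx 0 j) z a b) @ y -->
    derive_in D g (delta_mx 0 j) y a b by exact: (mx_cvgP _ _).1 c1 a b.
rewrite /prop_for /continuous_at (dgE y Dy); apply: cvg_near_eq c2.
by apply: filterS (nD y Dy) => z Dz; rewrite dgE.
Qed.

(** The chain rule along the straight line [h *: w + y]. *)
Lemma C1_derive (R : realType) (n : nat) (f : 'rV[R]_n -> R) (y w : 'rV[R]_n) :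
  C1_at f y -> is_derive y w f (\sum_c w 0 c * 'D_(delta_mx 0 c) f y).
Proof.
move=> fC1.
have c1 : (fun h : R => h^-1 *: ((h *: w + y) - y)) @ 0^' --> w.
  have cw : (fun=> w) @ (0 : R)^' --> w by exact: cvg_cst.
  apply: cvg_near_eq cw.
  near=> h; rewrite addrK scalerA mulVf ?scale1r//.
  by near: h; exact: nbhs_dnbhs_neq.
have fw := cvg_chain fC1 (fun A => id) c1.
by split; [apply/cvg_ex; eexists; exact: fw|by apply: cvg_lim => //; exact: fw].
Unshelve. all: by end_near. Qed.

Section Cylinder.
Context {R : realType} {n : nat} (N : riemannianManifold R n).
Variables (T1 T2 : R) (u : R * R -> N).
Hypothesis T12 : T1 < T2.
Hypothesis hu : smooth_map T1 T2 u.

Let S := strip T1 T2.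
Let D (i : atlasIndex N) := chart_preimage T1 T2 u i.
Let Du (i : atlasIndex N) := du T1 T2 u i.
Let coord (i : atlasIndex N) (p : R * R) : 'rV[R]_n := atlas i (u p).

Lemma chart_preimage_near (i : atlasIndex N) p : D i p ->
  \forall q \near p, S q -> D i q.
Proof.
move=> [Sp Dp].
have cu := (subspace_continuousP _ _).1 hu.1 p Sp.
have {}cu : \forall q \near p, S q -> cdom (atlas i) (u q).
  by apply: cu; apply: open_nbhs_nbhs; split => //; exact: cdom_open.
by apply: filterS cu => q uq Sq; split=> //; exact: uq.
Qed.

Lemma interior_strip_near (p : R * R) : T1 < p.1 < T2 ->
  \forall q \near p, T1 < q.1 < T2.
Proof.
move=> pT; have c1 : {for p, continuous (fst : R * R -> R)} by exact: cvg_fst.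
have : \forall s \near p.1, T1 < s < T2.
  have := @near_in_itvoo R T1 T2 p.1; rewrite in_itv /= => /(_ pT).
  by apply: filterS => s; rewrite in_itv.
by move=> /c1.
Qed.

(** Makes limits of restricted quotients unique: admissible nonzero increments exist arbitrarily
    close to 0, even on the boundary of the strip, where only one sign of [h] is allowed in
    direction [d_t]. *)
Lemma proper_increments (A : set (R * R)) (v p : R * R) :
  S p -> v = d_t \/ v = d_theta -> (\forall q \near p, S q -> A q) ->
  ProperFilter (within [set h | A (shift p (h *: v))] (0 : R)^').
Proof.
move=> Sp dv Ap; apply: Build_ProperFilter_ex => P wP.
have nA := near_shift_line v Ap.
have {wP nA} : \forall h \near (0 : R)^', S (shift p (h *: v)) -> P h.
  by apply: filterS2 nA wP => h Ah AP Sh; exact/AP/Ah.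
move=> /nbhs_ballP[e /= e0 eP].
have [h [h0 he Sh]] : exists h : R, [/\ h != 0, `|h| < e & S (shift p (h *: v))].
  have [T1p pT2] := andP Sp; pose e' := Num.min (e / 2) (T2 - T1) / 2.
  have m0 : 0 < Num.min (e / 2) (T2 - T1) by rewrite lt_min divr_gt0//= subr_gt0.
  have e'0 : 0 < e' by rewrite divr_gt0.
  have m1 : Num.min (e / 2) (T2 - T1) <= e / 2 by rewrite ge_min lexx.
  have m2 : Num.min (e / 2) (T2 - T1) <= T2 - T1 by rewrite ge_min lexx orbT.
  have e'e : e' < e by rewrite /e'; lra.
  have e'T : e' <= (T2 - T1) / 2 by rewrite /e'; lra.
  have S_line (h : R) : T1 <= h + p.1 <= T2 -> S (shift p (h *: v)).
    move=> hT; case: dv => ->; rewrite /S /strip /=.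
      by rewrite [h *: 1]mulr1.
    by rewrite [h *: 0]mulr0 add0r T1p.
  (* Move towards the farther end of the strip; a step of at most half its width stays inside. *)
  have [pm|pm] := leP p.1 ((T1 + T2) / 2).
    exists e'; split; first by rewrite gt_eqF.
      by rewrite gtr0_norm.
    by apply: S_line; apply/andP; split; lra.
  exists (- e'); split; first by rewrite oppr_eq0 gt_eqF.
    by rewrite normrN gtr0_norm.
  by apply: S_line; apply/andP; split; lra.
exists h; apply: eP => //.
by rewrite -ball_normE /ball_/= sub0r normrN.
Qed.

(** What has to be checked is that the overlap is open: [cinv] is continuous on the open image of
    the first chart, and the domain of the second is open. *)
Lemma transition_C1 (i j : atlasIndex N) y a k :
  overlap (atlas i) (atlas j) y ->
  C1_at (fun y => transition (atlas i) (atlas j) y a k) y.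
Proof.
move=> oy; apply: smooth_C1_at oy a k; last exact: transition_smooth.
rewrite openE => z [iz jz]; rewrite /interior.
have nz : \forall x \near z, cimg (atlas i) x.
  by apply: open_nbhs_nbhs; split => //; exact: cimg_open.
have : {in cimg (atlas i), continuous (cinv (atlas i))}.
  rewrite -continuous_open_subspace; [exact: cinv_continuous|exact: cimg_open].
move=> /(_ z); rewrite inE => /(_ iz) cz.
have {}cz : \forall x \near z, cdom (atlas j) (cinv (atlas i) x).
  by apply: cz; apply: open_nbhs_nbhs; split => //; exact: cdom_open.
by apply: filterS2 nz cz => x.
Qed.

Lemma coord_overlap (i j : atlasIndex N) p : D i p -> D j p ->
  overlap (atlas i) (atlas j) (coord i p) /\
  transition (atlas i) (atlas j) (coord i p) = coord j p.
Proof.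
move=> [_ ip] [_ jp]; have [iy uE] := cmapP ip.
by rewrite /overlap /transition /coord /= uE.
Qed.

Lemma du_cvg (i : atlasIndex N) (v p : R * R) : D i p ->
  quotient_in (D i) (coord i) p v --> Du i v p.
Proof. by move=> Dp; have [_ /(_ v)[/(_ p Dp)]] := hu.2 i 1%N. Qed.

(* Both difference quotients are followed along the increments that stay in the
   two chart domains, where they are related by the transition map. *)
Lemma du_transition (i j : atlasIndex N) (v p : R * R) :
  v = d_t \/ v = d_theta -> D i p -> D j p ->
  Du j v p = 'D_(Du i v p) (transition (atlas i) (atlas j)) (coord i p).
Proof.
move=> dv Dip Djp; have [oy tE] := coord_overlap Dip Djp.
have nD : \forall q \near p, S q -> (D i `&` D j) q.
  apply: filterS2 (chart_preimage_near Dip) (chart_preimage_near Djp).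
  by move=> q Diq Djq Sq; split; [exact: Diq|exact: Djq].
(* Increments admissible for both charts. Both quotients still converge along this finer filter, and
   its properness identifies their limits. *)
set F := within [set h | (D i `&` D j) (shift p (h *: v))] (0 : R)^'.
have FF : ProperFilter F by apply: proper_increments dv nD; exact: Dip.1.
have iF : (fun h => h^-1 *: (coord i (shift p (h *: v)) - coord i p)) @ F --> Du i v p.
  apply: cvg_trans (du_cvg (v := v) Dip) => A wA.
  have {}wA : \forall h \near (0 : R)^', D i (shift p (h *: v)) ->
    A (h^-1 *: (coord i (shift p (h *: v)) - coord i p)) by exact: wA.
  suff : \forall h \near (0 : R)^', (D i `&` D j) (shift p (h *: v)) ->
    A (h^-1 *: (coord i (shift p (h *: v)) - coord i p)) by [].
  by apply: filterS wA => h hA [Dh _]; exact: hA.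
have jF : (fun h => h^-1 *: (coord j (shift p (h *: v)) - coord j p)) @ F --> Du j v p.
  apply: cvg_trans (du_cvg (v := v) Djp) => A wA.
  have {}wA : \forall h \near (0 : R)^', D j (shift p (h *: v)) ->
    A (h^-1 *: (coord j (shift p (h *: v)) - coord j p)) by exact: wA.
  suff : \forall h \near (0 : R)^', (D i `&` D j) (shift p (h *: v)) ->
    A (h^-1 *: (coord j (shift p (h *: v)) - coord j p)) by [].
  by apply: filterS wA => h hA [_ Dh]; exact: hA.
set tau := transition (atlas i) (atlas j).
have dtau : derivable tau (coord i p) (Du i v p).
  apply/derivable_mxP => a k.
  exact: @ex_derive _ _ _ _ _ _ _ (C1_derive (Du i v p) (transition_C1 a k oy)).
apply/rowP => k; rewrite derive_mx// mxE.
rewrite (@derive_val _ _ _ _ _ _ _ (C1_derive (Du i v p) (transition_C1 0 k oy))).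
have F0 : F `=>` (0 : R)^' by exact: cvg_within.
have tF := @cvg_chain _ _ _ _ _ F (@filter_filter _ _ FF) _ (transition_C1 0 k oy) F0 iF.
have jFk : (fun h => (h^-1 *: (coord j (shift p (h *: v)) - coord j p)) 0 k) @ F
  --> Du j v p 0 k by exact: (mx_cvgP _ _).1 jF 0 k.
suff kF : (fun h => (h^-1 *: (coord j (shift p (h *: v)) - coord j p)) 0 k) @ F
  --> \sum_c Du i v p 0 c *
    'D_(delta_mx 0 c) (fun y => transition (atlas i) (atlas j) y 0 k) (coord i p).
  exact: (cvg_unique _ jFk kF).
apply: cvg_near_eq tF.
have wF : \forall h \near F, (D i `&` D j) (shift p (h *: v)) by exact: withinT.
apply: filterS wF => h [Di Dj]; rewrite !mxE.
by have [_ ->] := coord_overlap Di Dj; rewrite tE.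
Qed.

(** Frees the scalar product from the chart chosen by [cid]: the transformation laws of the metric
    and of [du] compensate each other, on the boundary as well. *)
Lemma pullback_metricE (i : atlasIndex N) (v w p : R * R) :
  v = d_t \/ v = d_theta -> w = d_t \/ w = d_theta -> D i p ->
  pullback_metric T1 T2 u v w p =
  bilin (metric i (coord i p)) (Du i v p) (Du i w p).
Proof.
move=> dv dw Dp; rewrite /pullback_metric.
set j := projT1 _; have Djp : D j p.
  by split; [exact: Dp.1|exact: (projT2 (cid (atlas_cover (u p))))].
have [oy tE] := coord_overlap Djp Dp.
by rewrite (metric_transition oy) tE -!du_transition.
Qed.

End Cylinder.

(** * The Hopf differential of a harmonic map *)

Lemma complex_parts (R : realType) (a b c : R) :
  (a%:C - b%:C - 2 * 'i%C * c%:C)%C = Complex (a - b) (- (2 * c)).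
Proof.
rewrite -(rmorph_nat (real_complex R)).
by apply/eqP; rewrite eq_complex /=; apply/andP; split; apply/eqP; ring.
Qed.

Lemma is_derive_coord (R : realType) (V : normedModType R) (m k : nat)
    (f : V -> 'M[R]_(m, k)) (p v : V) (df : 'M[R]_(m, k)) :
  is_derive p v f df -> forall a b, is_derive p v (fun q => f q a b) (df a b).
Proof.
move=> [d <-] a b; have da := (derivable_mxP _ _ _).1 d a b.
by split; rewrite // derive_mx// mxE.
Qed.

Section HarmonicMap.
Context {R : realType} {n : nat} (N : riemannianManifold R n).
Variables (T1 T2 : R) (u : R * R -> N).
Hypothesis T12 : T1 < T2.
Hypothesis hu : harmonic_map T1 T2 u.

Let hs : smooth_map T1 T2 u. Proof. by case: hu. Qed.

Let S := strip T1 T2.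
Let D (i : atlasIndex N) := chart_preimage T1 T2 u i.
Let Du (i : atlasIndex N) := du T1 T2 u i.
Let Ddu (i : atlasIndex N) := ddu T1 T2 u i.
Let coord (i : atlasIndex N) (p : R * R) : 'rV[R]_n := atlas i (u p).
(** Interior points of the cylinder seen in the chart [i], where the restricted derivatives are
    ordinary ones. *)
Let P (i : atlasIndex N) p := T1 < p.1 < T2 /\ D i p.
Let dG (i : atlasIndex N) (y : 'rV[R]_n) (c : 'I_n) : 'M[R]_n :=
  \matrix_(a, b) 'D_(delta_mx 0 c) (fun y => metric i y a b) y.
Let pm v w := pullback_metric T1 T2 u v w.
Let dir (v : R * R) := v = d_t \/ v = d_theta.

Let in_chart p : T1 < p.1 < T2 -> exists i, P i p.
Proof.
move=> pT; have [i ip] := atlas_cover (u p); exists i; split => //; split => //.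
by have /andP[? ?] := pT; rewrite /strip /= !ltW.
Qed.

Let P_near i p : P i p -> \forall q \near p, P i q.
Proof.
move=> [pT Dp]; apply: filterS2 (interior_strip_near pT) (chart_preimage_near hs Dp).
move=> q qT Dq; split => //; apply: Dq.
by have /andP[? ?] := qT; rewrite /strip /= !ltW.
Qed.

Let D_near i p : P i p -> \forall q \near p, D i q.
Proof. by move=> Pp; apply: filterS (P_near Pp) => q []. Qed.

Let cvg_in_strip (W : topologicalType) i (f : R * R -> W) p :
  {within D i, continuous f} -> D i p -> f @ within S (nbhs p) --> f p.
Proof.
move=> cf Dp; apply: cvg_trans ((subspace_continuousP _ _).1 cf p Dp) => A wA.
have {}wA : \forall q \near p, D i q -> A (f q) by exact: wA.
suff : \forall q \near p, S q -> A (f q) by [].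
apply: filterS2 wA (chart_preimage_near hs Dp) => q qA Dq Sq.
exact/qA/Dq.
Qed.

Let cvg_interior (W : topologicalType) i (f : R * R -> W) p :
  {within D i, continuous f} -> P i p -> f @ p --> f p.
Proof.
move=> cf Pp; apply: cvg_trans ((subspace_continuousP _ _).1 cf p Pp.2) => A wA.
have {}wA : \forall q \near p, D i q -> A (f q) by exact: wA.
suff : \forall q \near p, A (f q) by [].
by apply: filterS2 wA (D_near Pp) => q qA /qA.
Qed.

Let coord_cont i : {within D i, continuous (coord i)}.
Proof. exact: (hs.2 i 0%N).1. Qed.

Let Du_cont i v : {within D i, continuous (Du i v)}.
Proof. exact: ((hs.2 i 1%N).2 v).2.1. Qed.

Let Ddu_cont i w v : {within D i, continuous (Ddu i w v)}.
Proof. exact: (((hs.2 i 2%N).2 v).2.2 w).2.1. Qed.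

Let metric_cvg (i : atlasIndex N) y : cimg (atlas i) y -> metric i @ y --> metric i y.
Proof.
move=> iy; have := (metric_smooth i 0%N).1.
rewrite continuous_open_subspace; last exact: cimg_open.
by move=> /(_ y); rewrite inE; apply.
Qed.

Let coord_img i p : D i p -> cimg (atlas i) (coord i p).
Proof. by move=> [_ /cmapP[]]. Qed.

(** The chart selected in [pullback_metric] may jump from point to point, so one chart is fixed near
    [p]; there the coordinates and first derivatives of [u] are continuous up to the boundary. *)
Lemma pullback_metric_continuous v w : dir v -> dir w ->
  {within S, continuous (pm v w)}.
Proof.
move=> dv dw; apply/subspace_continuousP => p Sp.
have [i Dp] : exists i, D i p by have [i ip] := atlas_cover (u p); exists i.
suff : pm v w @ within S (nbhs p) --> pm v w p by [].
rewrite /pm (pullback_metricE T12 hs dv dw Dp).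
have gp := cvg_comp _ _ (cvg_in_strip (@coord_cont i) Dp) (metric_cvg (coord_img Dp)).
have bp : (fun q => bilin (metric i (coord i q)) (Du i v q) (Du i w q))
    @ within S (nbhs p) --> bilin (metric i (coord i p)) (Du i v p) (Du i w p).
  by apply: (cvg_bilin gp); apply: cvg_in_strip => //; exact: Du_cont.
apply: cvg_near_eq bp.
have Dn := chart_preimage_near hs Dp.
suff : \forall q \near p, S q -> pullback_metric T1 T2 u v w q =
  bilin (metric i (coord i q)) (Du i v q) (Du i w q) by [].
by apply: filterS Dn => q Dq Sq; rewrite (pullback_metricE T12 hs dv dw (Dq Sq)).
Qed.

Let coord_derive i v p : P i p -> is_derive p v (coord i) (Du i v p).
Proof.
move=> Pp; apply: is_derive_in (D_near Pp) _.
exact: ((hs.2 i 1%N).2 v).1 p Pp.2.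
Qed.

Let Du_derive i v w p : P i p -> is_derive p w (Du i v) (Ddu i w v p).
Proof.
move=> Pp; apply: is_derive_in (D_near Pp) _.
exact: (((hs.2 i 2%N).2 v).2.2 w).1 p Pp.2.
Qed.

(** [derive_comm] for each coordinate of [u]: near an interior point, [ddu] consists of ordinary
    iterated derivatives, continuous by smoothness. *)
Let Ddu_comm i v w p : P i p -> Ddu i w v p = Ddu i v w p.
Proof.
move=> Pp; apply/rowP => k; pose f q := coord i q 0 k.
have d1 z q : P i q -> is_derive q z f (Du i z q 0 k).
  by move=> Pq; exact: is_derive_coord (coord_derive z Pq) 0 k.
have d2 z z' q : P i q -> is_derive q z' ('D_z f) (Ddu i z' z q 0 k).
  move=> Pq; have := is_derive_coord (Du_derive z z' Pq) 0 k.
  apply: near_eq_is_derive; apply: filterS (P_near Pq) => q' Pq'.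
  by rewrite (@derive_val _ _ _ _ _ _ _ (d1 z q' Pq')).
have c2 z z' : {for p, continuous ('D_z' ('D_z f))}.
  have c : (fun q => Ddu i z' z q 0 k) @ p --> Ddu i z' z p 0 k.
    exact: (mx_cvgP _ _).1 (cvg_interior (@Ddu_cont i z' z) Pp) 0 k.
  rewrite /prop_for /continuous_at (@derive_val _ _ _ _ _ _ _ (d2 z z' p Pp)).
  apply: cvg_near_eq c; apply: filterS (P_near Pp) => q Pq.
  by rewrite (@derive_val _ _ _ _ _ _ _ (d2 z z' q Pq)).
apply: etrans (esym (@derive_val _ _ _ _ _ _ _ (d2 v w p Pp))) _.
apply: etrans (@derive_val _ _ _ _ _ _ _ (d2 w v p Pp)).
apply: derive_comm.
- by apply: filterS (P_near Pp) => q Pq; exact: @ex_derive _ _ _ _ _ _ _ (d1 v q Pq).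
- by apply: filterS (P_near Pp) => q Pq; exact: @ex_derive _ _ _ _ _ _ _ (d1 w q Pq).
- by apply: filterS (P_near Pp) => q Pq; exact: @ex_derive _ _ _ _ _ _ _ (d2 v w q Pq).
- by apply: filterS (P_near Pp) => q Pq; exact: @ex_derive _ _ _ _ _ _ _ (d2 w v q Pq).
- exact: c2.
- exact: c2.
Qed.

(** The derivative along [z] of [g(du(v), du(w))] in the chart [i], expanded by the product rule
    into the shape of [D] in [conformal_identities]. *)
Let dpm i z v w p := bilin (\sum_c Du i z p 0 c *: dG i (coord i p) c) (Du i v p) (Du i w p)
  + bilin (metric i (coord i p)) (Ddu i z v p) (Du i w p)
  + bilin (metric i (coord i p)) (Du i v p) (Ddu i z w p).

Let metric_C1 i p a b : D i p -> C1_at (fun y => metric i y a b) (coord i p).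
Proof.
move=> Dp; apply: smooth_C1_at (coord_img Dp) a b; first exact: cimg_open.
exact: metric_smooth.
Qed.

Let pm_derive i z v w p : dir v -> dir w -> P i p ->
  is_derive p z (pm v w) (dpm i z v w p).
Proof.
move=> dv dw Pp.
have : is_derive p z (fun q => bilin (metric i (coord i q)) (Du i v q) (Du i w q))
    (dpm i z v w p).
  apply: is_derive_bilin => [a b|a|a].
  - have -> : (\sum_c Du i z p 0 c *: dG i (coord i p) c) a b =
        \sum_c Du i z p 0 c * 'D_(delta_mx 0 c) (fun y => metric i y a b) (coord i p).
      by rewrite summxE; apply: eq_bigr => c _; rewrite !mxE.
    exact: is_derive_mx_comp (fun a b => metric_C1 a b Pp.2) (coord_derive z Pp) a b.
  - exact: is_derive_coord (Du_derive v z Pp) 0 a.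
  - exact: is_derive_coord (Du_derive w z Pp) 0 a.
apply: near_eq_is_derive; apply: filterS (P_near Pp) => q [_ Dq].
by rewrite /pm (pullback_metricE T12 hs dv dw Dq).
Qed.

Let dpm_cvg i z v w p : P i p -> dpm i z v w @ p --> dpm i z v w p.
Proof.
move=> Pp; have Dp := Pp.2.
have cc := cvg_interior (@coord_cont i) Pp.
have cD v' := cvg_interior (@Du_cont i v') Pp.
have cDD v' := cvg_interior (@Ddu_cont i z v') Pp.
have cg : (fun q => metric i (coord i q)) @ p --> metric i (coord i p).
  exact: (cvg_comp _ _ cc (metric_cvg (coord_img Dp))).
have cdG : (fun q => \sum_c Du i z q 0 c *: dG i (coord i q) c) @ p -->
    \sum_c Du i z p 0 c *: dG i (coord i p) c.
  apply: cvg_sum => c; apply: cvgZ; first exact: (mx_cvgP _ _).1 (cD z) 0 c.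
  apply/mx_cvgP => a b; have [_ cab] := metric_C1 a b Dp c.
  rewrite mxE; under eq_fun do rewrite mxE.
  exact: (cvg_comp _ _ cc cab).
apply: cvgD; first apply: cvgD; exact: cvg_bilin.
Qed.

Let pm_dcont z v w p : dir v -> dir w -> T1 < p.1 < T2 ->
  derivable (pm v w) p z /\ {for p, continuous ('D_z (pm v w))}.
Proof.
move=> dv dw pT; have [i Pp] := in_chart pT.
split; first exact: @ex_derive _ _ _ _ _ _ _ (pm_derive z dv dw Pp).
rewrite /prop_for /continuous_at (@derive_val _ _ _ _ _ _ _ (pm_derive z dv dw Pp)).
have c : dpm i z v w @ p --> dpm i z v w p by exact: dpm_cvg.
apply: cvg_near_eq c; apply: filterS (P_near Pp) => q Pq.
by rewrite (@derive_val _ _ _ _ _ _ _ (pm_derive z dv dw Pq)).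
Qed.

Let hopf_re p := pm d_t d_t p - pm d_theta d_theta p.
Let hopf_im p := - (2 * pm d_t d_theta p).

Let dirt : dir d_t. Proof. by left. Qed.
Let dirtheta : dir d_theta. Proof. by right. Qed.

Let hopf_re_derive i z p : P i p ->
  is_derive p z hopf_re (dpm i z d_t d_t p - dpm i z d_theta d_theta p).
Proof. by move=> Pp; apply: is_deriveB; exact: pm_derive. Qed.

Let hopf_im_derive i z p : P i p ->
  is_derive p z hopf_im (- (2 * dpm i z d_t d_theta p)).
Proof.
move=> Pp; apply: is_deriveN; have := pm_derive z dirt dirtheta Pp => ?.
by apply: (is_deriveZ 2).
Qed.

(** The two identities say that the t-derivative of [hopf_re] is the theta-derivative of [hopf_im],
    and that the t-derivative of [hopf_im] is minus the theta-derivative of [hopf_re]. *)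
Let cauchy_riemann i p : P i p ->
  dpm i d_t d_t d_t p - dpm i d_t d_theta d_theta p =
    - (2 * dpm i d_theta d_t d_theta p) /\
  2 * dpm i d_t d_t d_theta p =
    dpm i d_theta d_t d_t p - dpm i d_theta d_theta d_theta p.
Proof.
move=> Pp; have [_ Dp] := Pp.
have gu : metric i (coord i p) \in unitmx.
  by apply: posdef_unitmx; exact: metric_pos (coord_img Dp).
have gs := Defs.metric_sym (coord_img Dp).
have dGs c : (dG i (coord i p) c)^T = dG i (coord i p) c.
  apply/matrixP => a b; rewrite !mxE; apply: near_eq_derive.
  have : \forall y \near coord i p, cimg (atlas i) y.
    by apply: open_nbhs_nbhs; split; [exact: cimg_open|exact: coord_img].
  by apply: filterS => y iy; rewrite -[in LHS](Defs.metric_sym iy) mxE.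
have ten : Ddu i d_t d_t p + Ddu i d_theta d_theta p + \row_k \sum_a \sum_b
    (2^-1 * \sum_l invmx (metric i (coord i p)) k l *
      (dG i (coord i p) a b l + dG i (coord i p) b a l - dG i (coord i p) l a b)) *
    (Du i d_t p 0 a * Du i d_t p 0 b + Du i d_theta p 0 a * Du i d_theta p 0 b) = 0.
  have [_ _ /(_ i p Dp) <-] := hu; congr (_ + _).
  apply/rowP => k; rewrite !mxE; apply: eq_bigr => a _; apply: eq_bigr => b _.
  by congr (_ * _ * _); apply: eq_bigr => l _; rewrite !mxE.
have := conformal_identities (Ddu i d_t d_theta p) gu gs dGs ten.
by rewrite /dpm (Ddu_comm d_t d_theta Pp).
Qed.

Let shift_period (p : R * R) : S p -> u (p.1, p.2 + 2 * pi) = u p.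
Proof. by case: p => t x; have [+ _ _] := hu; apply. Qed.

(** As [u] takes the same value at both points, the definition selects the same chart at both.
    Translation by a period preserves the chart preimage and every difference quotient. *)
Let pm_periodic v w p : S p -> pm v w (p.1, p.2 + 2 * pi) = pm v w p.
Proof.
move=> Sp; rewrite /pm /pullback_metric (shift_period Sp).
set i := projT1 _.
suff DuE z : Du i z (p.1, p.2 + 2 * pi) = Du i z p by rewrite -/(Du _) !DuE.
have shE h : shift (p.1, p.2 + 2 * pi) (h *: z) =
    ((shift p (h *: z)).1, (shift p (h *: z)).2 + 2 * pi).
  by congr (_, _) => /=; rewrite addrA.
have DE q : D i (q.1, q.2 + 2 * pi) = D i q.
  apply/propeqP; rewrite /D /chart_preimage /=; split=> -[Sq].
    by rewrite /= shift_period.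
  by move=> ?; split => //=; rewrite shift_period.
rewrite /Du /du /derive_in; congr lim.
(* [Q] unfolds the restricted limit one increment at a time; agreement for each [h] makes the two
   filters equal. *)
pose Q (p' : R * R) (A : set 'rV[R]_n) (h : R) := D i (shift p' (h *: z)) ->
  A (h^-1 *: (coord i (shift p' (h *: z)) - coord i p')).
have QE p' A : quotient_in (D i) (coord i) p' z A = \forall h \near (0 : R)^', Q p' A h.
  by [].
suff E A h : Q (p.1, p.2 + 2 * pi) A h <-> Q p A h.
  rewrite -/(coord i) -/(D i); apply/seteqP.
  by split=> A; rewrite !QE; apply: filterS => h /E.
rewrite /Q shE DE /coord (shift_period Sp).
by split=> H Dq; move: (H Dq); rewrite (shift_period Dq.1).
Qed.

Lemma hopf_integral t t' : T1 <= t <= T2 -> T1 <= t' <= T2 ->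
  circle_integral (fun theta => hopf T1 T2 u (t, theta)) =
  circle_integral (fun theta => hopf T1 T2 u (t', theta)).
Proof.
move=> tT t'T.
have cont v w : dir v -> dir w -> forall p, S p ->
   pm v w @ within S (nbhs p) --> pm v w p.
  by move=> dv dw; exact/subspace_continuousP/pullback_metric_continuous.
have per v w s : T1 < s < T2 -> pm v w (s, 2 * pi) = pm v w (s, 0).
  move=> /andP[? ?]; rewrite -[2 * pi]add0r.
  by apply: (@pm_periodic v w (s, 0)); rewrite /S /strip /= !ltW.
have hopfE s x : hopf T1 T2 u (s, x) = Complex (hopf_re (s, x)) (hopf_im (s, x)).
  exact: complex_parts.
have intE s : circle_integral (fun theta => hopf T1 T2 u (s, theta)) =
    Complex (\int[lebesgue_measure]_(x in `[0, 2 * pi]) hopf_re (s, x))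
      (\int[lebesgue_measure]_(x in `[0, 2 * pi]) hopf_im (s, x)).
  by apply: (f_equal2 (@Complex R)); apply: eq_Rintegral => x _; rewrite hopfE.
apply: (etrans (intE t)); apply: (etrans _ (esym (intE t'))).
apply: (f_equal2 (@Complex R)).
  (* For the real part, the periodic angular primitive is the imaginary part. *)
  apply: (@conserved_integral _ T1 T2 hopf_re hopf_im T12 _ _ _ _ t t' tT t'T).
  - apply/subspace_continuousP => p Sp; apply: cvgB; exact: cont.
  - move=> p pT; have [i Pp] := in_chart pT.
    have [d1 c1] := pm_dcont d_t dirt dirt pT.
    have [d2 c2] := pm_dcont d_t dirtheta dirtheta pT.
    split; first exact: derivableB.
    have reD q : T1 < q.1 < T2 ->
        'D_d_t hopf_re q = 'D_d_t (pm d_t d_t) q - 'D_d_t (pm d_theta d_theta) q.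
      move=> qT; apply: deriveB.
        exact: (pm_dcont d_t dirt dirt qT).1.
      exact: (pm_dcont d_t dirtheta dirtheta qT).1.
    rewrite /prop_for /continuous_at reD//; apply: cvg_near_eq (cvgB c1 c2).
    by apply: filterS (interior_strip_near pT) => q qT; rewrite reD.
  - move=> p pT; have [i Pp] := in_chart pT.
    rewrite (@derive_val _ _ _ _ _ _ _ (hopf_re_derive d_t Pp)).
    by rewrite (cauchy_riemann Pp).1; exact: hopf_im_derive.
  - by move=> s sT; rewrite /hopf_im per.
(* For the imaginary part, it is minus the real part. *)
apply: (@conserved_integral _ T1 T2 hopf_im (fun p => - hopf_re p) T12 _ _ _ _ t t' tT t'T).
- apply/subspace_continuousP => p Sp; apply: cvgN; apply: cvgMl_tmp; exact: cont.
- move=> p pT; have [i Pp] := in_chart pT.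
  have [d c] := pm_dcont d_t dirt dirtheta pT.
  split; first exact: @ex_derive _ _ _ _ _ _ _ (hopf_im_derive d_t Pp).
  have imD q : T1 < q.1 < T2 ->
      'D_d_t hopf_im q = - (2 * 'D_d_t (pm d_t d_theta) q).
    move=> qT; have [j Pq] := in_chart qT.
    rewrite (@derive_val _ _ _ _ _ _ _ (hopf_im_derive d_t Pq)).
    by rewrite (@derive_val _ _ _ _ _ _ _ (pm_derive d_t dirt dirtheta Pq)).
  rewrite /prop_for /continuous_at imD//.
  apply: cvg_near_eq (cvgN (cvgMl_tmp (a := 2) c)).
  by apply: filterS (interior_strip_near pT) => q qT; rewrite imD.
- move=> p pT; have [i Pp] := in_chart pT.
  rewrite (@derive_val _ _ _ _ _ _ _ (hopf_im_derive d_t Pp)).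
  by rewrite (cauchy_riemann Pp).2; apply: is_deriveN; exact: hopf_re_derive.
- by move=> s sT; rewrite /hopf_re !per.
Qed.

End HarmonicMap.

Theorem lemma3p3 (R : realType) (n : nat) (N : riemannianManifold R n)
    (hN : compact [set: N]) (T1 T2 : R) (hT : 2 < T2 - T1)
    (u : R * R -> N) (hu : harmonic_map T1 T2 u) :
  forall t t' : R, T1 <= t <= T2 -> T1 <= t' <= T2 ->
    circle_integral (fun theta => hopf T1 T2 u (t, theta)) =
    circle_integral (fun theta => hopf T1 T2 u (t', theta)).
Proof.
have T12 : T1 < T2 by lra.
by move=> t t'; exact: hopf_integral.
Qed.
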